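(* Let $\mathcal G$ be a directed acyclic graph on the vertex set $V=\{X_1,\dots,X_r\}$ and let $\mathcal T=\{P(v\mid \mathrm{pa}(v)) : v\in V\}\cup\{N\}$ be the set of conditional and marginal distributions (a marginal when $\mathrm{pa}(v)=\emptyset$) given by $\mathcal G$, together with the grand total $N$, observed from an $r$-way contingency table $\mathbf n^0$ of nonnegative integers with grand total $N$ in which all marginal counts of configurations of $\mathrm{pa}(v)$, $v\in V$, are positive. Let $\mathcal G^u$ be the undirected graph associated with $\mathcal T$. If $\mathcal G$ satisfies the Wermuth condition, then, with the cells listed in the same order, a Markov basis describing $\mathcal T$ is the same as a Markov basis induced by the set of marginals associated with $\mathcal G^u$; that is, a finite set of moves is a Markov basis of the constraint matrix $M_{\mathcal T}$ if and only if it is a Markov basis of the constraint matrix $M_{\mathcal G^u}$.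
   Context: $X_1,\dots,X_r$ are categorical variables with finitely many levels each; a table is an array of nonnegative integer counts indexed by the level combinations (cells), with $d$ cells in total. For $v\in V$, $\mathrm{pa}(v)$ is the set of parents of $v$ in $\mathcal G$. The undirected graph $\mathcal G^u$ associated with $\mathcal T$ is the graph on $V$ obtained from $\mathcal G$ by replacing every directed edge by an undirected edge. The DAG $\mathcal G$ satisfies the Wermuth condition (is perfect) if no child has two parents that are not directly connected by an edge. The set of marginals associated with $\mathcal G^u$ is the collection of marginal tables over the maximal cliques of $\mathcal G^u$. For $S\subseteq V$ and a configuration $a$ of the variables in $S$, let $f_S(a)$ denote the corresponding marginal entry of an array $f$ (with $f_\emptyset$ the total sum of $f$). The constraint matrix $M_{\mathcal T}$ is the matrix (with denominators cleared row by row) of the linear map sending an array $f$ to its total sum and to the entries $f_{\{v\}\cup\mathrm{pa}(v)}(x,a)-P(v=x\mid \mathrm{pa}(v)=a)\,f_{\mathrm{pa}(v)}(a)$, over all $v\in V$, all levels $x$ of $v$ and all configurations $a$ of $\mathrm{pa}(v)$. The constraint matrix $M_{\mathcal G^u}$ is the matrix of the linear map sending $f$ to all its marginal tables over the maximal cliques of $\mathcal G^u$. For an integer matrix $T$ with $d$ columns and an integer vector $t$, the fiber is $\mathcal F_t=\{f\in\mathbb N^d: Tf=t\}$ (with $0\in\mathbb N$). A Markov basis of $T$ is a finite set of vectors (moves) $f_1,\dots,f_L\in\mathbb Z^d$ with $Tf_l=0$ for all $l$ such that for every $t$ and all $f,g\in\mathcal F_t$ there are $(\epsilon_1,f_{l_1}),\dots,(\epsilon_R,f_{l_R})$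 with $\epsilon_q=\pm1$, $g=f+\sum_{q=1}^R\epsilon_qf_{l_q}$, and $f+\sum_{q=1}^a\epsilon_qf_{l_q}\ge0$ for all $1\le a\le R$. *)

(* Defs.v *)
From HB Require Import structures.
From mathcomp Require Import all_boot all_order all_algebra finmap.

Set Implicit Arguments.
Unset Strict Implicit.
Unset Printing Implicit Defensive.

Import Order.TTheory GRing.Theory Num.Theory.
Local Open Scope ring_scope.

Section Graphs.
Variable r : nat.
Implicit Types (E e : rel 'I_r) (v : 'I_r).

(* [E u v] is the directed edge u -> v. [cycle E [:: v] = E v v], so loops are
   excluded as well. *)
Definition acyclic E : Prop := forall s : seq 'I_r, cycle E s -> s = [::].

Definition pa E v : {set 'I_r} := [set u | E u v].

Definition undirected E : rel 'I_r := [rel u v | E u v || E v u].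

Definition wermuth E : Prop :=
  forall v u w, u \in pa E v -> w \in pa E v -> u != w -> undirected E u w.

Definition clique e (C : {set 'I_r}) : bool :=
  [forall u in C, forall w in C, (u != w) ==> e u w].

Definition maxclique e (C : {set 'I_r}) : bool := maxset (clique e) C.

End Graphs.

Section Tables.
Variables (r : nat) (L : 'I_r -> finType).

Definition cell := {dffun forall v : 'I_r, L v}.

Definition config (S : {set 'I_r}) :=
  {dffun forall u : {u : 'I_r | u \in S}, L (val u)}.

Definition restr (S : {set 'I_r}) (c : cell) : config S :=
  [ffun u : {u : 'I_r | u \in S} => c (val u)].

Definition grand_total (R : nmodType) (f : cell -> R) : R := \sum_c f c.

Definition marginal (R : nmodType) (f : cell -> R) (S : {set 'I_r})
    (a : config S) : R :=
  \sum_(c : cell | restr S c == a) f c.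

(* The entry f_({v} :|: S)(x, a) of the marginal table over {v} :|: S, for v
   outside S: the configuration of {v} :|: S is given as the pair of a level x
   of v and a configuration a of S. *)
Definition marginal1 (R : nmodType) (f : cell -> R) (v : 'I_r)
    (S : {set 'I_r}) (x : L v) (a : config S) : R :=
  \sum_(c : cell | (c v == x) && (restr S c == a)) f c.

(* The matrix of a linear map from arrays to I-indexed families: column j is
   the image of the indicator array of the j-th listed cell. *)
Definition matrix_of_map (R : pzRingType) (I : finType) (d : nat)
    (cells : 'I_d -> cell) (phi : (cell -> R) -> I -> R) : 'M[R]_(#|I|, d) :=
  \matrix_(i, j) phi (fun c => (c == cells j)%:R) (enum_val i).

End Tables.

Definition row_denom m d (A : 'M[rat]_(m, d)) (i : 'I_m) : nat :=
  \big[lcmn/1%N]_(j < d) `|denq (A i j)|%N.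

(* [numq] only serves to read off an integer, see [clear_denomsE]. *)
Definition clear_denoms m d (A : 'M[rat]_(m, d)) : 'M[int]_(m, d) :=
  \matrix_(i, j) numq ((row_denom A i)%:R * A i j).

Lemma row_denom_gt0 m d (A : 'M[rat]_(m, d)) i : (0 < row_denom A i)%N.
Proof.
rewrite /row_denom; elim/big_ind: _ => // [x y x0 y0|j _].
  by rewrite lcmn_gt0 x0 y0.
by rewrite absz_gt0 denq_neq0.
Qed.

Lemma clear_denomsE m d (A : 'M[rat]_(m, d)) i j :
  (clear_denoms A i j)%:~R = (row_denom A i)%:R * A i j.
Proof.
rewrite mxE; have /dvdnP[q ->] : (`|denq (A i j)| %| row_denom A i)%N.
  by rewrite /row_denom (bigD1 j) //= dvdn_lcml.
rewrite natrM [X in _ * X * _]pmulrn absz_denq.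
rewrite -mulrA [X in _ * X]mulrC -numqE.
by rewrite [q%:R]pmulrn -intrM numq_int.
Qed.

Section ConstraintMatrices.
Variables (r : nat) (L : 'I_r -> finType) (E : rel 'I_r).

Definition cond_prob (n0 : cell L -> nat) (v : 'I_r) (x : L v)
    (a : config L (pa E v)) : rat :=
  (marginal1 n0 x a)%:R / (marginal n0 a)%:R.

(* [None] indexes the grand total. *)
Definition row_T : finType :=
  option {v : 'I_r & (L v * config L (pa E v))%type}.

Definition map_T (n0 : cell L -> nat) (f : cell L -> rat) (i : row_T) : rat :=
  match i with
  | None => grand_total f
  | Some (existT v (x, a)) =>
      marginal1 f x a - cond_prob n0 x a * marginal f a
  end.

Definition M_T (n0 : cell L -> nat) (d : nat) (cells : 'I_d -> cell L) :
    'M[int]_(#|row_T|, d) :=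
  clear_denoms (matrix_of_map cells (map_T n0)).

Definition row_Gu : finType :=
  {C : {C : {set 'I_r} | maxclique (undirected E) C} & config L (val C)}.

Definition map_Gu (f : cell L -> int) (i : row_Gu) : int :=
  marginal f (tagged i).

Definition M_Gu (d : nat) (cells : 'I_d -> cell L) : 'M[int]_(#|row_Gu|, d) :=
  matrix_of_map cells map_Gu.

End ConstraintMatrices.

Section MarkovBases.
Variables (m d : nat) (T : 'M[int]_(m, d)).

Definition int_vec (f : 'cV[nat]_d) : 'cV[int]_d := map_mx Posz f.

Definition in_fiber (t : 'cV[int]_m) (f : 'cV[nat]_d) : Prop :=
  T *m int_vec f = t.

(* A pair (b, z) is the signed move (-1)^b z. *)
Definition walk_end (f : 'cV[int]_d) (s : seq (bool * 'cV[int]_d)) :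
    'cV[int]_d :=
  f + \sum_(q <- s) (-1) ^+ q.1 *: q.2.

Definition markov_basis (B : {fset 'cV[int]_d}) : Prop :=
  (forall z, z \in B -> T *m z = 0) /\
  forall (t : 'cV[int]_m) (f g : 'cV[nat]_d), in_fiber t f -> in_fiber t g ->
    exists s : seq (bool * 'cV[int]_d),
      [/\ forall q, q \in s -> q.2 \in B,
          int_vec g = walk_end (int_vec f) s
        & forall n, (1 <= n <= size s)%N ->
            forall j, 0 <= walk_end (int_vec f) (take n s) j 0].

End MarkovBases.

(* Main.v *)
Require Import Defs.
From mathcomp Require Import all_boot all_order all_algebra finmap.

(** A Markov basis of a matrix [T] depends on [T] only through its integer
    kernel, since two tables lie in a common fiber exactly when their difference
    is in the kernel ([markov_basis_ker]).  So it is enough that both constraint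
    matrices have the same kernel, and this holds because both kernels consist
    of the arrays all of whose clique marginals vanish.

    The graph theory enters through a single fact ([clique_sub_family]).  Order
    the vertices topologically; the last vertex [v] of a clique [C] receives an
    edge from every other vertex of [C], so [C] is contained in the family
    [v |: pa E v].  Under the Wermuth condition the families are themselves
    cliques, so the families and the maximal cliques of the undirected graph
    bound each other, and vanishing marginals pass to subsets
    ([vanish_subset]).

    It remains to see that an array in the kernel of the conditional constraints
    has vanishing family marginals ([vanish_family]).  The constraint at [v]
    expresses the marginal over the family of [v] as a multiple of the marginal
    over [pa E v].  The latter set is empty, and then its marginal is the total,
    which is zero; or it is a clique, hence lies in the family of one of its own
    vertices, which precedes [v], and induction applies.  Either way the family
    marginal is a multiple of zero. *)

Import GRing.Theory.
Local Open Scope ring_scope.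

(** * Markov bases and kernels *)

Lemma markov_basis_ker_imp {m m' d : nat} (T : 'M[int]_(m, d))
    (T' : 'M[int]_(m', d)) (B : {fset 'cV[int]_d}) :
  (forall z : 'cV_d, T *m z = 0 <-> T' *m z = 0) ->
  markov_basis T B -> markov_basis T' B.
Proof.
move=> kerE [B_ker B_conn]; split=> [z zB|t f g ft gt].
  by apply/kerE; apply: B_ker.
apply: (B_conn (T *m int_vec f)) => //.
apply/eqP; rewrite -subr_eq0 -mulmxBr; apply/eqP/kerE.
by rewrite mulmxBr ft gt subrr.
Qed.

Lemma markov_basis_ker {m m' d : nat} (T : 'M[int]_(m, d))
    (T' : 'M[int]_(m', d)) (B : {fset 'cV[int]_d}) :
  (forall z : 'cV_d, T *m z = 0 <-> T' *m z = 0) ->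
  markov_basis T B <-> markov_basis T' B.
Proof.
move=> kerE; split; apply: markov_basis_ker_imp => // z.
by split=> /kerE.
Qed.

(** * Cliques of a perfect directed acyclic graph *)

(** The number of ancestors serves as a topological order. *)
Definition depth {r : nat} (E : rel 'I_r) (v : 'I_r) : nat :=
  #|[set u | connect E u v]|.

(** The ancestors of [u] are ancestors of [v], and [v] itself is a new one, as
    otherwise the edge from [u] to [v] would close a cycle. *)
Lemma depth_edge {r : nat} {E : rel 'I_r} :
  acyclic E -> forall u v, E u v -> (depth E u < depth E v)%N.
Proof.
move=> acyclic_E u v Euv; apply: proper_card; apply/properP; split.
  apply/subsetP=> w; rewrite !inE => wu.
  exact: connect_trans wu (connect1 Euv).
exists v; rewrite !inE ?connect0 //; apply/negP => /connectP[p vp u_last].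
suff /acyclic_E : cycle E (v :: p) by [].
by rewrite /= rcons_path vp -u_last.
Qed.

Definition family {r : nat} (E : rel 'I_r) (v : 'I_r) : {set 'I_r} :=
  v |: pa E v.

(** The vertex [v] is the last one of the clique in topological order, so that
    every edge between [v] and the rest of the clique points to [v]. *)
Lemma clique_sub_family {r : nat} {E : rel 'I_r} {C : {set 'I_r}} :
  acyclic E -> clique (undirected E) C -> C != set0 ->
  exists2 v, v \in C & C \subset family E v.
Proof.
move=> acyclic_E clC /set0Pn[v0 v0C].
case: (arg_maxnP (depth E) v0C) => v vC v_max; exists v => //.
apply/subsetP=> w wC; rewrite !inE; case: eqVneq => //= neq_wv.
move/forall_inP: clC => /(_ w wC)/forall_inP/(_ v vC).
rewrite neq_wv /= => /orP[//|Evw].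
by have := v_max w wC; rewrite /= leqNgt (depth_edge acyclic_E).
Qed.

Lemma clique_pa {r : nat} {E : rel 'I_r} (v : 'I_r) :
  wermuth E -> clique (undirected E) (pa E v).
Proof.
move=> wermuth_E; apply/forall_inP=> u uv; apply/forall_inP=> w wv.
by apply/implyP; apply: wermuth_E uv wv.
Qed.

Lemma clique_family {r : nat} {E : rel 'I_r} (v : 'I_r) :
  wermuth E -> clique (undirected E) (family E v).
Proof.
move=> wermuth_E; apply/forall_inP=> u uF; apply/forall_inP=> w wF.
apply/implyP=> neq_uw; move: uF wF neq_uw.
rewrite /family !in_setU1 => /predU1P[->|uv] /predU1P[->|wv].
- by rewrite eqxx.
- by move: wv; rewrite inE /undirected /= => ->; rewrite orbT.
- by move: uv; rewrite inE /undirected /= => ->.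
- exact: wermuth_E uv wv.
Qed.

(** * Vanishing marginals *)

Section Vanishing.
Context {r : nat} {L : 'I_r -> finType} {R : nmodType}.
Variable f : cell L -> R.

Definition vanish (S : {set 'I_r}) : Prop :=
  forall a : config L S, marginal f a = 0.

Lemma restr_eqP (S : {set 'I_r}) (c c' : cell L) :
  restr S c = restr S c' <-> {in S, forall u, c u = c' u}.
Proof.
split=> [eq_cc' u uS|eq_cc'].
  by have /ffunP/(_ (exist _ u uS)) := eq_cc'; rewrite !ffunE.
by apply/ffunP=> -[u uS]; rewrite !ffunE /=; apply: eq_cc'.
Qed.

(** A region cut out by the coordinates in [S] is a disjoint union of cylinders
    over configurations of [S], and [f] sums to zero over each of them. *)
Lemma vanish_sum (S : {set 'I_r}) (P : pred (cell L)) :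
  (forall c c', restr S c = restr S c' -> P c = P c') ->
  vanish S -> \sum_(c | P c) f c = 0.
Proof.
move=> P_restr S0; rewrite (partition_big (restr S) xpredT) //=.
apply: big1 => b _.
case: (pickP (fun c => P c && (restr S c == b))) => [c0|none]; last first.
  exact: big_pred0.
case/andP=> Pc0 /eqP<-; rewrite -[RHS](S0 (restr S c0)).
by apply: eq_bigl => c; apply: andb_idl => /eqP/P_restr->.
Qed.

Lemma vanish_subset (S S' : {set 'I_r}) :
  S' \subset S -> vanish S -> vanish S'.
Proof.
move=> sS'S S0 a; apply: vanish_sum S0 => c c' /restr_eqP eq_cc'.
suff -> : restr S' c = restr S' c' by [].
by apply/restr_eqP=> u /(subsetP sS'S)/eq_cc'.
Qed.

Lemma vanish_set0 : vanish set0 <-> grand_total f = 0.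
Proof.
split=> [f0|f0 a].
  by apply: vanish_sum f0.
rewrite -[RHS]f0; apply: eq_bigl => c; apply/eqP/ffunP=> -[u u0].
by have := u0; rewrite inE.
Qed.

Lemma vanish_setU1 (v : 'I_r) (S : {set 'I_r}) :
  vanish (v |: S) <->
  forall (x : L v) (a : config L S), marginal1 f x a = 0.
Proof.
have restrU1 (c c' : cell L) : (restr (v |: S) c == restr (v |: S) c') =
    (c v == c' v) && (restr S c == restr S c').
  apply/eqP/andP => [/restr_eqP eq_cc'|[/eqP eq_v /eqP/restr_eqP eq_S]].
    split; apply/eqP; first by apply: eq_cc'; rewrite setU11.
    by apply/restr_eqP=> u uS; apply: eq_cc'; rewrite setU1r.
  by apply/restr_eqP=> u /setU1P[->|/eq_S].
split=> [f0 x a|f0 a].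
  apply: vanish_sum f0 => c c' /eqP; rewrite restrU1.
  by case/andP=> /eqP-> /eqP->.
case: (pickP (fun c => restr (v |: S) c == a)) => [c0 /eqP<-|none]; last first.
  exact: big_pred0.
rewrite -[RHS](f0 (c0 v) (restr S c0)); apply: eq_bigl => c.
exact: restrU1.
Qed.

(** The conditional constraints force the family marginals to vanish, one vertex
    at a time in topological order.  The constraints enter only through the
    implication that a vanishing marginal over the parents gives a vanishing
    marginal over the family. *)
Lemma vanish_family (E : rel 'I_r) :
  acyclic E -> wermuth E -> grand_total f = 0 ->
  (forall v, vanish (pa E v) -> vanish (family E v)) ->
  forall v, vanish (family E v).
Proof.
move=> acyclic_E wermuth_E f0 step v.
have [n] := ubnP (depth E v); elim: n v => // n IHn v le_vn; apply: step.
have [->|pa_n0] := eqVneq (pa E v) set0; first exact/vanish_set0.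
have [u] := clique_sub_family acyclic_E (clique_pa v wermuth_E) pa_n0.
rewrite inE => Euv sub_u; apply: vanish_subset sub_u _; apply: IHn.
by rewrite -ltnS; apply: leq_trans le_vn; rewrite ltnS (depth_edge acyclic_E).
Qed.

(** Families and maximal cliques bound each other.  The total is a separate
    condition on the left because a graph without vertices has no family,
    whereas the empty set is its maximal clique. *)
Lemma vanish_families_cliques (E : rel 'I_r) :
  acyclic E -> wermuth E ->
  (grand_total f = 0 /\ forall v, vanish (family E v)) <->
  (forall C, maxclique (undirected E) C -> vanish C).
Proof.
move=> acyclic_E wermuth_E; split=> [[tot0 fam0] C|max0].
  case/maxsetP=> clC _; have [->|C_n0] := eqVneq C set0.
    exact/vanish_set0.
  have [v _ sub_v] := clique_sub_family acyclic_E clC C_n0.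
  exact: vanish_subset sub_v (fam0 v).
have clique0 D : clique (undirected E) D -> vanish D.
  case/maxset_exists=> C maxC sDC.
  exact: vanish_subset sDC (max0 C maxC).
split=> [|v]; last exact/clique0/clique_family.
apply/vanish_set0/clique0; apply/forall_inP=> u.
by rewrite inE.
Qed.

End Vanishing.

(** * Kernels of the constraint matrices *)

Lemma big_indicator {R : pzRingType} {I : finType} (P : pred I) (f : I -> R) :
  \sum_(c | P c) f c = \sum_c (P c)%:R * f c.
Proof.
rewrite big_mkcond; apply: eq_bigr => c _.
by case: (P c); rewrite (mul1r, mul0r).
Qed.

(** The hypothesis is the linearity of the row [i] of [phi], given by its
    coefficients. *)
Lemma matrix_of_mapE {r : nat} {L : 'I_r -> finType} {R : pzRingType}
    {I : finType} {d : nat} (cells : 'I_d -> cell L)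
    (phi : (cell L -> R) -> I -> R) (i : 'I_#|I|) (w f : cell L -> R) :
  bijective cells ->
  (forall g, phi g (enum_val i) = \sum_c w c * g c) ->
  \sum_j matrix_of_map cells phi i j * f (cells j) = phi f (enum_val i).
Proof.
move=> cells_bij phiE; rewrite phiE (reindex cells); last exact: onW_bij.
apply: eq_bigr => j _; rewrite mxE phiE (bigD1 (cells j)) //= eqxx mulr1.
rewrite big1 ?addr0 // => c /negPf->.
by rewrite mulr0.
Qed.

Lemma clear_denoms_mulmx_eq0 {m d : nat} (A : 'M[rat]_(m, d))
    (z : 'cV[int]_d) i :
  (clear_denoms A *m z) i 0 = 0 <-> \sum_j A i j * (z j 0)%:~R = 0.
Proof.
have -> : (clear_denoms A *m z) i 0 = 0 <->
    (row_denom A i)%:R * (\sum_j A i j * (z j 0)%:~R) = 0.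
  suff <- : ((clear_denoms A *m z) i 0)%:~R =
      (row_denom A i)%:R * (\sum_j A i j * (z j 0)%:~R) :> rat.
    by split=> [->|/eqP]; rewrite // intr_eq0 => /eqP.
  rewrite mxE rmorph_sum mulr_sumr; apply: eq_bigr => j _.
  by rewrite rmorphM /= clear_denomsE mulrA.
split=> [/eqP|->]; last by rewrite mulr0.
by rewrite mulf_eq0 Num.Theory.pnatr_eq0 gtn_eqF ?row_denom_gt0 //= => /eqP.
Qed.

Lemma mulmx_eq0P {m d : nat} (A : 'M[int]_(m, d)) (z : 'cV[int]_d) :
  A *m z = 0 <-> forall i, (A *m z) i 0 = 0.
Proof.
split=> [-> i|Az0]; first by rewrite mxE.
by apply/matrixP=> i j; rewrite ord1 Az0 mxE.
Qed.

Section Kernels.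
Context {r : nat} {L : 'I_r -> finType} {E : rel 'I_r} {d : nat}.
Context {cells : 'I_d -> cell L} {idx : cell L -> 'I_d}.
Hypotheses (cellsK : cancel cells idx) (idxK : cancel idx cells).
Variable z : 'cV[int]_d.

Let cells_bij : bijective cells := Bijective cellsK idxK.

Let f (c : cell L) : int := z (idx c) 0.

Lemma ker_M_Gu :
  M_Gu E cells *m z = 0 <->
  forall C, maxclique (undirected E) C -> vanish f C.
Proof.
have rowE i : (M_Gu E cells *m z) i 0 = map_Gu f (enum_val i).
  rewrite -(@matrix_of_mapE _ _ _ _ _ cells (@map_Gu r L E) i
    (fun c => (restr _ c == tagged (enum_val i))%:R)) //; last first.
    by move=> g; apply: big_indicator.
  by rewrite mxE; apply: eq_bigr => j _; rewrite /f cellsK.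
split=> [/mulmx_eq0P ker_z C maxC a|f0]; last first.
  apply/mulmx_eq0P=> i; rewrite rowE; apply: f0.
  exact: (valP (tag (enum_val i))).
pose i : row_Gu L E := Tagged (fun C => config L (val C)) (a : config L (val
  (exist (fun C => maxclique (undirected E) C) C maxC))).
by have := ker_z (enum_rank i); rewrite rowE enum_rankK.
Qed.

Lemma ker_M_T (n0 : cell L -> nat) :
  M_T E n0 cells *m z = 0 <->
  grand_total f = 0 /\
  forall (v : 'I_r) (x : L v) (a : config L (pa E v)),
    (marginal1 f x a)%:~R = cond_prob n0 x a * (marginal f a)%:~R.
Proof.
pose fQ c : rat := (f c)%:~R.
have rowE i : (M_T E n0 cells *m z) i 0 = 0 <-> map_T n0 fQ (enum_val i) = 0.
  rewrite clear_denoms_mulmx_eq0.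
  pose w (k : row_T L E) (c : cell L) : rat := match k with
    | None => 1
    | Some (existT v (x, a)) =>
        ((c v == x) && (restr (pa E v) c == a))%:R -
        cond_prob n0 x a * (restr (pa E v) c == a)%:R
    end.
  rewrite -(@matrix_of_mapE _ _ _ _ _ cells (map_T n0) i (w (enum_val i)))
    //; last first.
    move=> g; case: (enum_val i) => [[v [x a]]|] /=; last first.
      by apply: eq_bigr => c _; rewrite mul1r.
    rewrite [marginal1 _ _ _]big_indicator [marginal _ _]big_indicator.
    rewrite mulr_sumr -sumrB.
    by apply: eq_bigr => c _; rewrite mulrBl !mulrA.
  by under [X in _ <-> X = 0]eq_bigr => j _ do rewrite /fQ /f cellsK.
split=> [/mulmx_eq0P ker_z|[tot0 fam0]].
  have ker_row (k : row_T L E) : map_T n0 fQ k = 0.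
    by rewrite -[k]enum_rankK; apply/rowE/ker_z.
  split=> [|v x a].
    have /eqP := ker_row None; rewrite /= /grand_total -rmorph_sum intr_eq0.
    by move/eqP.
  have /eqP := ker_row (Some (existT _ v (x, a))).
  by rewrite /= subr_eq0 /marginal1 /marginal -!rmorph_sum => /eqP.
apply/mulmx_eq0P=> i; apply/rowE.
case: (enum_val i) => [[v [x a]]|] /=; last first.
  by rewrite /grand_total -rmorph_sum; move: tot0; rewrite /grand_total => ->.
apply/eqP; rewrite subr_eq0 /marginal1 /marginal -!rmorph_sum; apply/eqP.
exact: fam0.
Qed.

Lemma ker_M_T_M_Gu (n0 : cell L -> nat) :
  acyclic E -> wermuth E ->
  M_T E n0 cells *m z = 0 <-> M_Gu E cells *m z = 0.
Proof.
move=> acyclic_E wermuth_E.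
rewrite ker_M_Gu ker_M_T -vanish_families_cliques //.
split=> -[tot0 fam0]; split=> // v.
  apply: vanish_family => // {}v pa0; apply/vanish_setU1=> x a.
  by apply/eqP; rewrite -(@intr_eq0 rat) fam0 pa0 mulr0.
move=> x a; have /vanish_setU1-> := fam0 v.
by rewrite (vanish_subset _ _ _ (subsetU1 v (pa E v)) (fam0 v)) mulr0.
Qed.

End Kernels.

Theorem corollary3p7 (r : nat) (L : 'I_r -> finType) (E : rel 'I_r)
    (acyclic_E : acyclic E)
    (n0 : cell L -> nat) (N : nat) (total_n0 : grand_total n0 = N)
    (pa_pos : forall (v : 'I_r) (a : config L (pa E v)),
      (0 < marginal n0 a)%N)
    (wermuth_E : wermuth E)
    (d : nat) (cells : 'I_d -> cell L) (cells_bij : bijective cells)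
    (B : {fset 'cV[int]_d}) :
  markov_basis (M_T E n0 cells) B <-> markov_basis (M_Gu E cells) B.
Proof.
case: cells_bij => idx cellsK idxK; apply: markov_basis_ker => z.
exact: ker_M_T_M_Gu cellsK idxK z n0 acyclic_E wermuth_E.
Qed.
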